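(* Let $\mathbf{G}=\langle \Upsilon,\mathbf{S},\mathbf{R},\mathfrak{F}^{v}_{K_1,K_2},\Gamma_0\$\Delta_0\rangle$ be a multi-layer prefix grammar. Every infinite trace generated by $\mathbf{G}$ contains an infinite subsequence $\{\Gamma_{k}\$\Delta_{k}\}$ such that for every $\Gamma_{k_1}\$\Delta_{k_1}$, $\Gamma_{k_2}\$\Delta_{k_2}$ in it, $k_1<k_2$ implies $\Gamma_{k_1}\$\Delta_{k_1}\preceq\Gamma_{k_2}\$\Delta_{k_2}$, i.e. the two words form a Turchin pair.
   Context: **Labels and layered words.** $\Upsilon$ is a finite alphabet, $\mathbf{S}$ a label set with a strict partial order $\triangleleft$. For $\mathbf{S}'\subseteq\mathbf{S}$, $s_1$ is a child of $s_0$ w.r.t. $\mathbf{S}'$ if $s_0,s_1\in\mathbf{S}'$, $s_0\triangleleft s_1$, and there is no $s_2\in\mathbf{S}'$ with $s_0\triangleleft s_2\triangleleft s_1$. When $\mathbf{S}'$ is the set of all previously used labels, one writes $s_1=\mathrm{child}(s_0)$. Descendants of $s$ are the $t$ with $s\triangleleft t$, ancestors the $t$ with $t\triangleleft s$. A label $t\in\mathbf{S}\setminus\mathbf{S}'$ is fresh w.r.t. $\mathbf{S}'$ if $\mathbf{S}'$ contains neither descendants nor ancestors of $t$. A layered word is a finite sequence of pairs $\langle a,s\rangle$, $a\in\Upsilon$, $s\in\mathbf{S}$; $\Lambda$ is the empty word; $|\Phi|$ is the number of pairs in $\Phi$. The plain word of $\langle a_1,s_1\rangle\dots\langle a_n,s_n\rangle$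 is $a_1\dots a_n$. $\Phi\langle s\rangle$ is the maximal subsequence of $\Phi$ containing only pairs labelled $s$; $\mathbf{S}_\Phi$ is the set of labels in $\Phi$. For $\Psi\in\Upsilon^*$, $\Psi\langle s\rangle$ is $\Psi$ with all letters labelled $s$. **Layer functions.** For a label $s_i$ and natural numbers $K_1,K_2$, $\mathfrak{F}^{s_i}_{K_1,K_2}$ is the minimal set of functions from layered words to layered words containing all compositions of $K_1$ elementary functions. In the following list, $s_i$ is counted among the labels of $\Phi$ when children of $s_i$ are considered. The elementary functions are: (1) Append $\mathrm{App}^{s_j}[\Psi]$ ($\Psi\in\Upsilon^*$): maps $\Phi$ to $\Phi\,\Psi\langle s_j\rangle$, where $s_j$ is a child of $s_i$ w.r.t. $\mathbf{S}_\Phi\cup\{s_j\}$, $s_j$ is fresh w.r.t. $\mathbf{S}_\Phi\setminus\{s_i\}$ (though $s_j$ itself may already occur in $\Phi$; e.g. for $s_0\triangleleft s_1$ and $\mathrm{App}^{s_1}[g]\in\mathfrak{F}^{s_0}_{1,1}$, $\mathrm{App}^{s_1}[g](\langle f,s_0\rangle\langle g,s_1\rangle)=\langle f,s_0\rangle\langle g,s_1\rangle\langle g,s_1\rangle$), and $|\Psi|\le K_2$. (2) Insert $\mathrm{Ins}^{s_j}[\Psi\langle s_k\rangle]$ ($\Psi\in\Upsilon^*$): for $\Phi$ with non-empty $\Phi\langle s_j\rangle$, $s_j$ a child of $s_i$ w.r.t. $\mathbf{S}_\Phi$, returns $\Phi\,\Psi\langle s_k\rangle$, where $|\Psi|\le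 K_2$, $s_k$ is a child of $s_i$ w.r.t. $\mathbf{S}_\Phi\cup\{s_k\}$, $s_j$ is a child of $s_k$ w.r.t. $\mathbf{S}_\Phi\cup\{s_k\}$, and $s_k$ is fresh w.r.t. $\mathbf{S}_\Phi\setminus\{s_i\}$ (apart from $s_j$ and the descendants of $s_j$). (3) Delete $\mathrm{Del}^{s_j}$: for $\Phi$ with non-empty $\Phi\langle s_j\rangle$, $s_j$ a child of $s_i$ w.r.t. $\mathbf{S}_\Phi$, erases $\Phi\langle s_j\rangle$ and all $\Phi\langle t\rangle$ with $s_j\triangleleft t$. (4) Copy $\mathrm{Copy}^{s_j}$: for $\Phi$ with non-empty $\Phi\langle s_j\rangle$, $s_j$ a child of $s_i$ w.r.t. $\mathbf{S}_\Phi$, appends to $\Phi$ a copy of $\Phi\langle s_j\rangle$ labelled by $s_k$, where $s_k$ is a child of $s_i$ w.r.t. $\mathbf{S}_\Phi\cup\{s_k\}$ and is fresh w.r.t. $\mathbf{S}_\Phi\setminus\{s_i\}$; then it appends copies of all subsequences labelled by the children of $s_j$, labelled by fresh children of $s_k$, and so on, until every $\Phi\langle t\rangle$ with $s_j\triangleleft t$ is copied exactly once (i.e. it creates a copy of the subtree rooted at $s_j$ as a new subtree below $s_i$). **Multi-layer prefix grammar.** A tuple $\mathbf{G}=\langle \Upsilon,\mathbf{S},\mathbf{R},\mathfrak{F}^{v}_{K_1,K_2},\Gamma_0\$\Delta_0\rangle$, where $\$\notin\Upsilon$ is a special symbol; $\Gamma_0,\Delta_0$ are layered words such that if the pair $\langle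 a_i,s_i\rangle$ precedes $\langle a_j,s_j\rangle$ in $\Gamma_0$ then $s_j\triangleleft s_i$ or $s_j=s_i$; $\mathfrak{F}^{v}_{K_1,K_2}$ is a finite set of layer function forms, $v$ running over $\mathbf{S}$; and all rewriting rules in $\mathbf{R}$ have one of the forms - simple rule: $\Xi\langle a,s_i\rangle\Theta\$\Psi\to\Phi\Theta\$F^{s_i}(\Psi)$; - pop rule: $\Xi\langle a,s_i\rangle\Theta\$\Psi\to\Psi\langle s_j\rangle\Phi\Theta\$F^{s_i}(\Psi)$, where $\Psi\langle s_j\rangle$ is the maximal subsequence of $\Psi$ marked by some $s_j=\mathrm{child}(s_i)$ (a pop rule may specify $s_j$, but cannot specify $\Psi\langle s_j\rangle$). In both, all letters of $\Phi$ are labelled by $s_i$ or by fresh descendants of $s_i$, and $F^{s_i}\in\mathfrak{F}^{s_i}_{K_1,K_2}$. In a $\mathbf{G}$-word $\Gamma\$\Delta$, the layered words $\Gamma$ and $\Delta$ are the visible and the invisible layer. A trace of $\mathbf{G}$ is a sequence of $\mathbf{G}$-words starting at $\Gamma_0\$\Delta_0$ that are transformed by the rules from $\mathbf{R}$. **Permanently stable suffix.** Let $N$ be the maximal number of letters of the visible layer rewritten by a rule of $\mathbf{R}$ (so every rule rewrites at most $N$ letters of the visible layer). Given a trace $\{\Gamma_k\$\Delta_k\}$ and its segment $[i,j]$, a suffix $\Theta$ of $\Gamma_i$ is permanently stable w.r.t. $[i,j]$ if all the words $\Gamma_k\$\Delta_k$, $i\le k<j$, are of the form $\Phi_k\Theta\$\Delta_k$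 with $|\Phi_k|\ge N$, and $\Gamma_j=\Phi_j\Theta$, where $\Phi_j$ may be $\Lambda$. **Turchin pair.** Two words $\Xi_i=\Gamma_i\$\Delta_i$, $\Xi_j=\Gamma_j\$\Delta_j$ ($i<j$) of a trace form a Turchin pair, written $\Xi_i\preceq\Xi_j$, if $\Gamma_i=\Phi\Theta_0$, $\Gamma_j=\Phi'\Psi\Theta_0$, $\Phi$ equals $\Phi'$ as a plain word (up to the layer labels), and the suffix $\Theta_0$ is permanently stable w.r.t. $[i,j]$.
   Formalization: Permanent stability is taken with |Φ_k| ≥ min(N, |Γ_k|) instead of |Φ_k| ≥ N: with the literal bound the claim fails for the trace a, a, a, … of the grammar with rules a→a and aa→Λ (N = 2), whose visible layers are shorter than N. *)

(* Defs.v *)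
From mathcomp Require Import all_boot all_order.

Set Implicit Arguments.
Unset Strict Implicit.
Unset Printing Implicit Defensive.

Import Order.TTheory.
Local Open Scope order_scope.

Section LayeredWords.

(* [U] is the alphabet; the strict partial order on the labels is [<] on [S]. *)
Context {U : finType} {d : Order.disp_t} {S : porderType d}.

Definition lword := seq (U * S).

Definition plain (w : lword) : seq U := [seq x.1 | x <- w].
Definition labels (w : lword) : seq S := [seq x.2 | x <- w].
Definition layer (w : lword) (s : S) : lword := [seq x <- w | x.2 == s].
Definition at_label (u : seq U) (s : S) : lword := [seq (a, s) | a <- u].

(* The finite label set S' is given by a list. *)
Definition child (L : seq S) (s0 s1 : S) : bool :=
  [&& s0 \in L, s1 \in L, s0 < s1
    & all (fun s2 => ~~ ((s0 < s2) && (s2 < s1))) L].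

Definition fresh (L : seq S) (t : S) : bool :=
  (t \notin L) && all (fun u => ~~ (t < u) && ~~ (u < t)) L.

(* Elementary layer functions, with their label arguments. *)
Inductive elem :=
  | App of S & seq U           (* App^{sj}[Psi] *)
  | Ins of S & seq U & S       (* Ins^{sj}[Psi<sk>] *)
  | Del of S                   (* Del^{sj} *)
  | Copy of S.                 (* Copy^{sj} *)

Definition elem_bounded (K2 : nat) (e : elem) : bool :=
  match e with
  | App _ u | Ins _ u _ => (size u <= K2)%N
  | Del _ | Copy _ => true
  end.

(* [sj] may already occur in [w], hence it is also discarded from the labels
   with respect to which it has to be fresh. *)
Definition app_dom (si : S) (w : lword) (sj : S) : bool :=
  child (si :: sj :: labels w) si sj
  && fresh [seq t <- labels w | (t != si) && (t != sj)] sj.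

Definition live_child (si : S) (w : lword) (sj : S) : bool :=
  (layer w sj != [::]) && child (si :: labels w) si sj.

Definition ins_dom (si : S) (w : lword) (sj sk : S) : bool :=
  [&& live_child si w sj,
      child (si :: sk :: labels w) si sk,
      child (si :: sk :: labels w) sk sj
    & fresh [seq t <- labels w | (t != si) && ~~ (sj <= t)] sk].

Definition relabel (w : lword) (s : S) : lword := at_label (plain w) s.

(* [ts] enumerates the subtree of [sj] in [w] (each label once, every label
   after its ancestors in the subtree) and [rho] carries this subtree
   isomorphically onto fresh labels below [si].  Since the labels [rho t] are
   incomparable with all labels of [w] other than [si], [rho] sends the
   children of [t] to children of [rho t].  The fresh labels and the order of
   unrelated blocks are not prescribed, so Copy is a relation. *)
Definition copy_rel (si : S) (w : lword) (sj : S) (w' : lword) : Prop :=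
  exists (rho : S -> S) (ts : seq S),
    [/\ uniq ts,
        forall t, (t \in ts) = (t \in labels w) && (sj <= t)
      & pairwise (fun t u => ~~ (u < t)) ts] /\
    [/\ {in ts &, {mono rho : t u / t <= u}},
        child (si :: rho sj :: labels w) si (rho sj),
        {in ts, forall t, fresh [seq u <- labels w | u != si] (rho t)}
      & w' = w ++ flatten [seq relabel (layer w t) (rho t) | t <- ts]].

(* Graph of an elementary function attached to the label [si]; [w] is outside
   its domain when it is related to no word. *)
Definition elem_rel (si : S) (e : elem) (w w' : lword) : Prop :=
  match e with
  | App sj u => app_dom si w sj /\ w' = w ++ at_label u sj
  | Ins sj u sk => ins_dom si w sj sk /\ w' = w ++ at_label u sk
  | Del sj => live_child si w sj /\ w' = [seq x <- w | ~~ (sj <= x.2)]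
  | Copy sj => live_child si w sj /\ copy_rel si w sj w'
  end.

(* The head of the list is applied first. *)
Fixpoint layer_rel (si : S) (F : seq elem) (w w' : lword) : Prop :=
  if F is e :: F' then
    exists2 w1, elem_rel si e w w1 & layer_rel si F' w1 w'
  else w' = w.

Definition layer_function (K1 K2 : nat) (F : seq elem) : bool :=
  (size F == K1) && all (elem_bounded K2) F.

(* [Pop (Some sj)] is a pop rule that specifies the child label [sj]. *)
Inductive rule_kind := Simple | Pop of option S.

(* Xi <a,si> Theta $ Psi -> [Psi<sj>] Phi Theta $ F^{si}(Psi). *)
Record rule := Rule {
  r_kind : rule_kind;
  r_Xi : lword;
  r_a : U;
  r_si : S;
  r_Phi : lword;
  r_F : seq elem
}.

(* Number of letters of the visible layer rewritten by a rule. *)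
Definition rewritten (r : rule) : nat := (size (r_Xi r)).+1.

(* A rule with label variables is represented by all its instances, so that
   [g_rules] is a possibly infinite set of rules with concrete labels. *)
Record grammar := Grammar {
  g_rules : rule -> Prop;
  g_K1 : nat;
  g_K2 : nat;
  g_Gamma0 : lword;
  g_Delta0 : lword;
  g_Gamma0_ordered : pairwise (fun x y : U * S => y.2 <= x.2) g_Gamma0;
  g_rules_layer :
    forall r, g_rules r -> layer_function g_K1 g_K2 (r_F r)
}.

(* The G-word Gamma $ Delta is the pair (Gamma, Delta). *)
Definition gword := (lword * lword)%type.
Definition visible (X : gword) : lword := X.1.
Definition invisible (X : gword) : lword := X.2.

(* Ancestors of [si] are ancestors of all its descendants, hence they are
   discarded together with [si]. *)
Definition fresh_descendant (used : seq S) (si t : S) : bool :=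
  (si < t) && fresh [seq u <- used | ~~ (u <= si)] t.

(* One rewriting step, where [used] lists the previously used labels. *)
Definition step (G : grammar) (used : seq S) (X Y : gword) : Prop :=
  exists r Theta,
    [/\ g_rules G r,
        visible X = r_Xi r ++ (r_a r, r_si r) :: Theta,
        all (fun t => (t == r_si r) || fresh_descendant used (r_si r) t)
            (labels (r_Phi r))
      & layer_rel (r_si r) (r_F r) (invisible X) (invisible Y)] /\
    match r_kind r with
    | Simple => visible Y = r_Phi r ++ Theta
    | Pop o =>
        exists sj,
          [/\ (if o is Some s then sj = s else True),
              child used (r_si r) sj
            & visible Y = layer (invisible X) sj ++ r_Phi r ++ Theta]
    end.

Definition used_labels (w : nat -> gword) (k : nat) : seq S :=
  flatten [seq labels (visible (w m)) ++ labels (invisible (w m))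
          | m <- iota 0 k.+1].

Definition infinite_trace (G : grammar) (w : nat -> gword) : Prop :=
  w 0 = (g_Gamma0 G, g_Delta0 G) /\
  forall k, step G (used_labels w k) (w k) (w k.+1).

(* [N] is the maximal number of visible letters rewritten by a rule. *)
Definition max_rewritten (G : grammar) (N : nat) : Prop :=
  (exists2 r, g_rules G r & rewritten r = N) /\
  (forall r, g_rules G r -> (rewritten r <= N)%N).

(* [Theta] stays out of the window of the first [N] letters of each word.
   When the visible layer has at least [N] letters the condition is
   [N <= size Phik]; a visible layer with fewer than [N] letters lies entirely
   in the window, and [Phik] has to be the whole layer.  Without the [minn], no
   suffix would be stable along a trace such as a, a, a, ... of a grammar with
   N = 2. *)
Definition permanently_stable
    (N : nat) (w : nat -> gword) (i j : nat) (Theta : lword) : Prop :=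
  (forall k, (i <= k < j)%N ->
     exists2 Phik, visible (w k) = Phik ++ Theta
                 & (minn N (size (visible (w k))) <= size Phik)%N) /\
  (exists Phij, visible (w j) = Phij ++ Theta).

Definition turchin_pair
    (N : nat) (w : nat -> gword) (i j : nat) : Prop :=
  (i < j)%N /\
  exists Phi Phi' Psi Theta0,
    [/\ visible (w i) = Phi ++ Theta0,
        visible (w j) = Phi' ++ Psi ++ Theta0,
        plain Phi = plain Phi'
      & permanently_stable N w i j Theta0].

End LayeredWords.

Arguments lword : clear implicits.
Arguments rule : clear implicits.
Arguments grammar : clear implicits.
Arguments gword : clear implicits.

(* Main.v *)
(* Call [i] a record if no later visible layer is shorter than that of [w i];
   records occur arbitrarily late.  After a record, everything below the first
   [N] letters stays out of the reach of the rules, so it is permanently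
   stable.  The plain words formed by the first [N] letters are finitely many,
   hence one of them recurs at infinitely many records, and any two of these
   form a Turchin pair. *)

Require Import Defs.
From mathcomp Require Import all_boot all_order.
From mathcomp Require Import boolp.

Definition frequently (Q : nat -> Prop) : Prop :=
  forall m, exists2 n, m <= n & Q n.

(** Infinite pigeonhole: if each value [t] occurred at [Q]-indices only below some [M t], a
    [Q]-index past the maximum of these finitely many bounds would have no value. *)
Lemma frequently_fiber {T : finType} (c : nat -> T) {Q : nat -> Prop} :
  frequently Q -> exists t, frequently (fun n => Q n /\ c n = t).
Proof.
move=> infQ; apply: contrapT => noT.
have bound t : exists m, forall n, m <= n -> Q n -> c n <> t.
  apply: contrapT => nob; apply: noT; exists t => m.
  apply: contrapT => nom; apply: nob; exists m => n le_mn Qn cnt.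
  by apply: nom; exists n.
have [M Mbound] := choice bound.
have [n le_n Qn] := infQ (\max_t M t).
exact: Mbound (leq_trans (leq_bigmax (c n)) le_n) Qn erefl.
Qed.

Lemma frequently_subsequence {Q : nat -> Prop} :
  frequently Q ->
  exists k : nat -> nat, {homo k : p q / p < q} /\ forall p, Q (k p).
Proof.
move=> infQ.
have /choice[f fP] m : exists n, m <= n /\ Q n.
  by have [n le_mn Qn] := infQ m; exists n.
exists (fun p => iter p (fun n => f n.+1) (f 0)); split.
  by apply: homo_ltn => [|p]; [exact: ltn_trans | exact: (fP _).1].
by case=> [|p]; exact: (fP _).2.
Qed.

Definition record (n : nat -> nat) (i : nat) : Prop :=
  forall j, i <= j -> n i <= n j.

(** Descent on a bound [v] for a value taken at or after [m]: once it cannot be lowered, the index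
    meeting it is a record. *)
Lemma frequently_record (n : nat -> nat) : frequently (record n).
Proof.
move=> m; have [v nv] : exists v, exists2 i, m <= i & n i <= v.
  by exists (n m), m.
elim: v nv => [|v IHv] [i le_mi le_iv].
  by exists i => // j _; apply: leq_trans le_iv _.
have [/IHv//|no_lower] := pselect (exists2 j, m <= j & n j <= v).
exists i => // j le_ij; apply: leq_trans le_iv _.
rewrite ltnNge; apply/negP => le_jv.
by apply: no_lower; exists j => //; apply: leq_trans le_ij.
Qed.

(** The [minn] leaves two cases: the cut at [m] falls inside [s], or [t] is empty. *)
Lemma drop_cat_window {T : Type} (m : nat) (s t : seq T) :
  minn m (size (s ++ t)) <= size s -> drop m (s ++ t) = drop m s ++ t.
Proof.
rewrite geq_min => /orP[le_ms|]; last first.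
  by rewrite size_cat -[leqRHS]addn0 leq_add2l leqn0 => /nilP->; rewrite !cats0.
rewrite drop_cat; case: ltnP => // le_sm.
by rewrite (@anti_leq m (size s)) ?le_ms // subnn drop0 drop_size.
Qed.

Section Trace.

Context {U : finType} {d : Order.disp_t} {S : porderType d}.
Variables (G : grammar U d S) (N : nat).
Hypothesis HN : max_rewritten G N.

(** Simple and pop rules alike replace a prefix inside the window; a popped layer merely joins the
    new prefix [P]. *)
Lemma step_visible {used} {X Y : gword U d S} :
  step G used X Y ->
  exists2 m, m <= minn N (size (visible X))
           & exists P, visible Y = P ++ drop m (visible X).
Proof.
case=> r [Theta [[Gr eqX _ _] eqY]]; exists (rewritten r).
  rewrite leq_min (proj2 HN) //= eqX size_cat /= addnS ltnS.
  exact: leq_addr.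
rewrite eqX -cat_rcons drop_size_cat; last by rewrite size_rcons.
case: (r_kind r) eqY => [->|o [sj [_ _ ->]]]; first by exists (r_Phi r).
by exists (layer (invisible X) sj ++ r_Phi r); rewrite catA.
Qed.

Variable w : nat -> gword U d S.
Hypothesis Hw : infinite_trace G w.

Lemma record_suffix {i j : nat} :
  record (fun k => size (visible (w k))) i -> i <= j ->
  exists2 Phi, visible (w j) = Phi ++ drop N (visible (w i))
             & minn N (size (visible (w j))) <= size Phi.
Proof.
move=> rec_i le_ij.
(* If [w i] has more than [N] visible letters, the record property leaves at least [N] letters
   before the suffix; otherwise the suffix is empty and [Phi] is the whole layer. *)
have window k Phi : i <= k ->
    visible (w k) = Phi ++ drop N (visible (w i)) ->
    minn N (size (visible (w k))) <= size Phi.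
  move=> le_ik eq_k; have := rec_i k le_ik.
  rewrite eq_k size_cat size_drop geq_min.
  case: (leqP (size (visible (w i))) N) => [le_iN _|lt_Ni].
    by move/eqP: le_iN => ->; rewrite addn0 leqnn orbT.
  by rewrite -{1}(subnKC (ltnW lt_Ni)) leq_add2r => ->.
suff [Phi eq_j] : exists Phi, visible (w j) = Phi ++ drop N (visible (w i)).
  by exists Phi => //; apply: window.
elim: j le_ij => [|j IHj].
  by rewrite leqn0 => /eqP->; exists (take N (visible (w 0))); rewrite cat_take_drop.
rewrite leq_eqVlt => /predU1P[<-|le_ij].
  by exists (take N (visible (w i))); rewrite cat_take_drop.
have [Phi eq_j] := IHj le_ij.
have [m le_m [P ->]] := step_visible (proj2 Hw j).
(* The [m] letters removed lie in the window, hence in [Phi], so the suffix survives. *)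
exists (P ++ drop m Phi); rewrite -catA eq_j drop_cat_window // -eq_j.
exact: leq_trans (geq_minl _ _) (leq_trans le_m (window _ _ le_ij eq_j)).
Qed.

Lemma record_turchin_pair (i j : nat) :
  record (fun k => size (visible (w k))) i -> i < j ->
  plain (take N (visible (w i))) = plain (take N (visible (w j))) ->
  turchin_pair N w i j.
Proof.
move=> rec_i lt_ij eq_plain; split=> //.
have [Phi eq_j win_j] := record_suffix rec_i (ltnW lt_ij).
(* [Psi] is the part of [Phi] beyond the window of [w j]. *)
exists (take N (visible (w i))), (take N (visible (w j))), (drop N Phi).
exists (drop N (visible (w i))); split=> //; first by rewrite cat_take_drop.
  by rewrite -drop_cat_window -eq_j // cat_take_drop.
split=> [k /andP[le_ik _]|]; first exact: record_suffix.
by exists Phi.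
Qed.

End Trace.

Theorem theorem2 (U : finType) (d : Order.disp_t) (S : porderType d)
    (G : grammar U d S) (N : nat) (HN : max_rewritten G N)
    (w : nat -> gword U d S) (Hw : infinite_trace G w) :
  exists k : nat -> nat,
    (forall p q : nat, (p < q)%N -> (k p < k q)%N) /\
    (forall p q : nat, (p < q)%N -> turchin_pair N w (k p) (k q)).
Proof.
pose top i := plain (take N (visible (w i))).
have size_top i : size (top i) <= N by rewrite size_map size_take_min geq_minl.
(* Plain words make the colours finite even if [S] is infinite; their lengths are only bounded,
   since a visible layer may have fewer than [N] letters. *)
have [u] := frequently_fiber (fun i => Bseq (size_top i))
  (frequently_record (fun i => size (visible (w i)))).
move=> /frequently_subsequence[k [k_incr kP]]; exists k; split=> // p q lt_pq.
have [[rec_p top_p] [_ top_q]] := (kP p, kP q).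
apply: (record_turchin_pair _ _ HN _ Hw) => //; first exact: k_incr.
by case: (etrans top_p (esym top_q)).
Qed.
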